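(* Let $\mathbb F$ be an algebraically closed field and $A(s)\in\mathbb F[s]^{p\times q}$ a matrix pencil of rank $\rho$. For $\lambda\in\overline{\mathbb F}$ let $n_1(\lambda,A(s))\ge\dots\ge n_\rho(\lambda,A(s))\ge0$ be the partial multiplicities of $\lambda$ in $A(s)$, and let $c_1\ge\dots\ge c_{q-\rho}$ be the column minimal indices of $A(s)$. Let $(w^R_1(\lambda,A(s)),w^R_2(\lambda,A(s)),\dots)$ be the conjugate partition of $(n_1(\lambda,A(s)),\dots,n_\rho(\lambda,A(s)))$, let $(r_1,r_2,\dots)$ be the conjugate partition of $(c_1,\dots,c_{q-\rho})$ and $r_0=q-\rho$. Then for every $\lambda\in\overline{\mathbb F}$, $$w(\lambda,A(s))=(w^R_1(\lambda,A(s)),w^R_2(\lambda,A(s)),\dots)+(r_0,r_1,\dots),$$ i.e. $w_i(\lambda,A(s))=w^R_i(\lambda,A(s))+r_{i-1}$ for all $i\ge1$.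
   Context: A matrix pencil is $A(s)=A_0+sA_1$, $A_0,A_1\in\mathbb F^{p\times q}$; its rank $\rho$ is its rank over $\mathbb F(s)$; $A(\infty):=A_1$. Homogeneous invariant factors $\phi_1\mid\cdots\mid\phi_\rho$ are the invariant factors of $tA_0+sA_1$ over $\mathbb F[s,t]$. Partial multiplicities: for $\lambda\in\mathbb F$, $n_i(\lambda,A(s))$ is the exponent of $(s-\lambda t)$ in $\phi_{\rho-i+1}(s,t)$; $n_i(\infty,A(s))$ is the exponent of $t$ in $\phi_{\rho-i+1}(s,t)$. Column minimal indices: the $q-\rho$ indices $k$ (zeros included) of blocks $L_k(s)\in\mathbb F[s]^{k\times(k+1)}$ ($s$ on the diagonal, $1$ on the superdiagonal) in the Kronecker canonical form. Conjugate of a finite nonincreasing sequence $(a_1,\dots,a_m)$ of nonnegative integers: $(\bar a_1,\bar a_2,\dots)$, $\bar a_k=\#\{i:a_i\ge k\}$. Jordan chain at $\lambda$ of length $k+1$: vectors $(x_k,\dots,x_0)$ in $\mathbb F^q$ with $x_0\ne0$ and, for $\lambda\in\mathbb F$, $A(\lambda)x_0=0$, $A(\lambda)x_i=-A_1x_{i-1}$ ($1\le i\le k$); for $\lambda=\infty$, $A_1x_0=0$, $A_1x_i=-A_0x_{i-1}$. $\mathcal L^\ell_\lambda(A(s))$ is the span of all vectors in Jordan chains at $\lambda$ of length $\le\ell$, $\mathcal L^0_\lambda=\{0\}$, and $w_i(\lambda,A(s))=\dim(\mathcal L^i_\lambda(A(s))/\mathcal L^{i-1}_\lambda(A(s)))$,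 $i\ge1$; $w(\lambda,A(s))=(w_1(\lambda,A(s)),w_2(\lambda,A(s)),\dots)$. *)

(* Defs.v *)
From HB Require Import structures.
From mathcomp Require Import all_boot all_order all_algebra.
From mathcomp Require Import fraction.
From mathcomp Require Import boolp.
Set Implicit Arguments. Unset Strict Implicit. Unset Printing Implicit Defensive.
Import Order.TTheory GRing.Theory Num.Theory.
Local Open Scope ring_scope.

Section Pencils.
Variable F : fieldType.

Definition pencil_frac p q (A0 A1 : 'M[F]_(p, q)) : 'M[{fraction {poly F}}]_(p, q) :=
  \matrix_(i, j) FracField.tofrac ((A0 i j)%:P + (A1 i j)%:P * 'X).

Definition pencil_rank p q (A0 A1 : 'M[F]_(p, q)) : nat :=
  \rank (pencil_frac A0 A1).

(* s is the outer variable 'X, t is the inner variable ('X)%:P. *)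
Definition hom_pencil p q (A0 A1 : 'M[F]_(p, q)) : 'M[{poly {poly F}}]_(p, q) :=
  \matrix_(i, j) ((A0 i j)%:P%:P * ('X)%:P + (A1 i j)%:P%:P * 'X).

Definition hdvd (d P : {poly {poly F}}) : Prop := exists r, P = r * d.

(* the linear form attached to lambda in F \cup {oo}:
   s - lambda t for lambda finite, t for lambda = oo (None) *)
Definition lin_form (lam : option F) : {poly {poly F}} :=
  match lam with
  | Some l => 'X - (l%:P * 'X)%:P
  | None => ('X)%:P
  end.

(* the exponent of the (prime) linear form lin_form lam in the k-th
   determinantal divisor D_k (gcd of all k x k minors) of t A0 + s A1, i.e. the
   largest e such that (lin_form lam)^e divides every k x k minor.  Minors of
   order k are homogeneous of degree k, so for k <= rank (some minor nonzero)
   this e is at most k. *)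
Definition detdiv_exp p q (A0 A1 : 'M[F]_(p, q)) (lam : option F) (k : nat) : nat :=
  \max_(e < k.+1 | `[< forall (f : 'I_k -> 'I_p) (g : 'I_k -> 'I_q),
                        hdvd (lin_form lam ^+ e) (\det (mxsub f g (hom_pencil A0 A1))) >]) e.

(* exponent of lin_form lam in the k-th homogeneous invariant factor
   phi_k = D_k / D_(k-1) *)
Definition hinv_exp p q (A0 A1 : 'M[F]_(p, q)) (lam : option F) (k : nat) : nat :=
  (detdiv_exp A0 A1 lam k - detdiv_exp A0 A1 lam k.-1)%N.

(* partial multiplicities n_i(lam, A), 1 <= i <= rho *)
Definition part_mult p q (A0 A1 : 'M[F]_(p, q)) (lam : option F) (i : nat) : nat :=
  hinv_exp A0 A1 lam (pencil_rank A0 A1 - i).+1.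

Definition wR p q (A0 A1 : 'M[F]_(p, q)) (lam : option F) (k : nat) : nat :=
  #|[set i : 'I_(pencil_rank A0 A1) | (k <= part_mult A0 A1 lam i.+1)%N]|.

Definition jordan_chain p q (A0 A1 : 'M[F]_(p, q)) (lam : option F)
    (xs : seq 'cV[F]_q) : Prop :=
  let P := match lam with Some l => A0 + l *: A1 | None => A1 end in
  let Q := match lam with Some _ => A1 | None => A0 end in
  [/\ (0 < size xs)%N, xs`_0 != 0 &
      forall i, (i < size xs)%N ->
        P *m xs`_i = if i == 0%N then 0 else - (Q *m xs`_i.-1)].

Definition chain_vecs p q (A0 A1 : 'M[F]_(p, q)) (lam : option F) (l : nat)
    (v : 'cV[F]_q) : Prop :=
  exists xs, jordan_chain A0 A1 lam xs /\ (size xs <= l)%N /\ v \in xs.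

Definition span_dim q (S : 'cV[F]_q -> Prop) : nat :=
  \max_(n < q.+1 | `[< exists X : seq 'cV[F]_q,
                        (forall x, x \in X -> S x) /\ \dim <<X>>%VS = n >]) n.

Definition Ldim p q (A0 A1 : 'M[F]_(p, q)) (lam : option F) (l : nat) : nat :=
  span_dim (chain_vecs A0 A1 lam l).

(* w_i(lam, A) = dim (L^i / L^(i-1)), i >= 1 *)
Definition wseq p q (A0 A1 : 'M[F]_(p, q)) (lam : option F) (i : nat) : nat :=
  (Ldim A0 A1 lam i - Ldim A0 A1 lam i.-1)%N.

Record blk := Blk { br : nat; bc : nat; b0 : 'M[F]_(br, bc); b1 : 'M[F]_(br, bc) }.

Fixpoint sum_r (l : seq blk) : nat := if l is b :: l' then (br b + sum_r l')%N else 0%N.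
Fixpoint sum_c (l : seq blk) : nat := if l is b :: l' then (bc b + sum_c l')%N else 0%N.

Fixpoint dsum0 (l : seq blk) : 'M[F]_(sum_r l, sum_c l) :=
  match l return 'M[F]_(sum_r l, sum_c l) with
  | [::] => 0
  | b :: l' => block_mx (b0 b) 0 0 (dsum0 l')
  end.
Fixpoint dsum1 (l : seq blk) : 'M[F]_(sum_r l, sum_c l) :=
  match l return 'M[F]_(sum_r l, sum_c l) with
  | [::] => 0
  | b :: l' => block_mx (b1 b) 0 0 (dsum1 l')
  end.

Inductive kblock :=
  | KL of nat            (* L_k, k x (k+1) : s on diagonal, 1 on superdiagonal *)
  | KLT of nat           (* L_k^T, (k+1) x k *)
  | KJ of F & nat        (* Jordan block (s - lam) I_k + N_k, finite eigenvalue lam *)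
  | KN of nat.           (* infinite block I_k + s N_k *)

Definition kblk (b : kblock) : blk :=
  match b with
  | KL k => @Blk k k.+1 (\matrix_(i, j) (j == i.+1 :> nat)%:R)
                        (\matrix_(i, j) (j == i :> nat)%:R)
  | KLT k => @Blk k.+1 k (\matrix_(i, j) (i == j.+1 :> nat)%:R)
                         (\matrix_(i, j) (i == j :> nat)%:R)
  | KJ l k => @Blk k k (\matrix_(i, j) ((j == i.+1 :> nat)%:R - (i == j :> nat)%:R * l))
                       (\matrix_(i, j) (i == j :> nat)%:R)
  | KN k => @Blk k k (\matrix_(i, j) (i == j :> nat)%:R)
                     (\matrix_(i, j) (j == i.+1 :> nat)%:R)
  end.

Definition is_KCF p q (A0 A1 : 'M[F]_(p, q)) (kb : seq kblock) : Prop :=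
  let l := map kblk kb in
  [/\ sum_r l = p, sum_c l = q &
      exists (P : 'M[F]_p) (Q : 'M[F]_q), [/\ P \in unitmx, Q \in unitmx,
        P *m A0 *m Q = conform_mx (0 : 'M[F]_(p, q)) (dsum0 l) &
        P *m A1 *m Q = conform_mx (0 : 'M[F]_(p, q)) (dsum1 l)]].

Definition col_min_indices (kb : seq kblock) : seq nat :=
  pmap (fun b => if b is KL k then Some k else None) kb.

End Pencils.

(* Main.v *)
Require Import Defs.
From HB Require Import structures.
From mathcomp Require Import all_boot all_order all_algebra.
From mathcomp Require Import fraction boolp.
From mathcomp Require Import perm ring zify.
Import Order.TTheory GRing.Theory Num.Theory.
Local Open Scope ring_scope.
Set Implicit Arguments. Unset Strict Implicit. Unset Printing Implicit Defensive.

(* Dropping the condition x_0 <> 0, the vectors in Jordan chains of length <= l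
   form the subspace V_l given by V_0 = 0 and V_(l+1) = A(lambda)^-1 (- A_1 V_l).
   It is compatible with strict equivalence and direct sums, and on each
   Kronecker block it is the coordinate subspace of the first (or last) l
   coordinates, or 0; a binomial matrix moves the eigenvalue lambda of L_k to 0.

   On the other side, let pi be the linear form attached to lambda.  Up to
   factors coprime to pi, each block of t A_0 + s A_1 is equivalent to a diagonal
   matrix of powers of pi: the identity, except for the k x k Jordan block at
   lambda, which gives 1, ..., 1, pi^k by a Schur complement.  The pi-exponent of
   the j-th determinantal divisor is then the sum of the j smallest exponents, so
   the partial multiplicities are these exponents. *)

(** * Divisibility of minors in a commutative ring *)

Section Divisibility.
Variable R : comNzRingType.
Implicit Types (d x y c : R).

Definition dvdr d x := exists r, x = r * d.

Lemma dvdr_mull d x y : dvdr d y -> dvdr d (x * y).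
Proof. by case=> r ->; exists (x * r); rewrite mulrA. Qed.

Lemma dvdr_sum d (I : finType) (G : I -> R) :
  (forall i, dvdr d (G i)) -> dvdr d (\sum_i G i).
Proof.
move=> dG; apply: (big_ind (dvdr d)) => [|x y [a ->] [b ->]|i _] //.
  by exists 0; rewrite mul0r.
by exists (a + b); rewrite mulrDl.
Qed.

Definition minors_dvd d k m n (M : 'M[R]_(m, n)) :=
  forall (f : 'I_k -> 'I_m) (g : 'I_k -> 'I_n), dvdr d (\det (mxsub f g M)).

(** A weak Cauchy-Binet formula, from expanding each row of the product. The maps [h] may be neither
    increasing nor injective, which is harmless for divisibility. *)
Lemma det_mxsub_mulmx k m n p (A : 'M[R]_(m, n)) (B : 'M[R]_(n, p))
    (f : 'I_k -> 'I_m) (g : 'I_k -> 'I_p) :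
  \det (mxsub f g (A *m B)) =
  \sum_(h : {ffun 'I_k -> 'I_n}) (\prod_i A (f i) (h i)) * \det (mxsub h g B).
Proof.
rewrite /determinant.
under [RHS]eq_bigr => h _ do rewrite big_distrr /=.
rewrite [RHS]exchange_big /=; apply: eq_bigr => s _.
under eq_bigr => i _ do rewrite !mxE.
rewrite bigA_distr_bigA big_distrr /=; apply: eq_bigr => h _.
rewrite big_split /= mulrCA; congr (_ * (_ * _)).
by apply: eq_bigr => i _; rewrite mxE.
Qed.

Lemma minors_dvd_tr d k m n (M : 'M[R]_(m, n)) :
  minors_dvd d k M -> minors_dvd d k M^T.
Proof. by move=> dM f g; rewrite -trmx_mxsub det_tr. Qed.

Lemma minors_dvd_mull d k m n p (P : 'M[R]_(m, n)) (M : 'M[R]_(n, p)) :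
  minors_dvd d k M -> minors_dvd d k (P *m M).
Proof.
move=> dM f g; rewrite det_mxsub_mulmx; apply: dvdr_sum => h.
exact/dvdr_mull/dM.
Qed.

Lemma minors_dvd_mulr d k m n p (M : 'M[R]_(m, n)) (Q : 'M[R]_(n, p)) :
  minors_dvd d k M -> minors_dvd d k (M *m Q).
Proof.
move=> dM; rewrite -[M *m Q]trmxK trmx_mul.
exact/minors_dvd_tr/minors_dvd_mull/minors_dvd_tr.
Qed.

(** Common shape of the Jordan blocks at finite and infinite eigenvalues, and, up to transposition,
    of an [L_k] with its first or last column deleted. *)
Definition bidiag (a b : R) n : 'M[R]_n :=
  \matrix_(i, j) (a *+ (i == j :> nat) + b *+ (j == i.+1 :> nat)).

Lemma det_bidiag a b n : \det (bidiag a b n) = a ^+ n.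
Proof.
rewrite -det_tr det_trig.
  rewrite (eq_bigr (fun _ => a)) ?prodr_const ?card_ord // => i _.
  by rewrite !mxE eqxx ltn_eqF ?addr0.
apply/is_trig_mxP => i j lt_ij; rewrite !mxE gtn_eqF // ltn_eqF ?addr0 //.
exact: leqW.
Qed.

End Divisibility.

(** * Equivalence of matrices up to factors coprime to [pi] *)

Section LocalEquivalence.
Variables (R : idomainType) (pi : R).
Hypotheses (pi_neq0 : pi != 0) (pi_ndvd1 : ~ dvdr pi 1).

(** Multiplication by [c] is injective modulo [pi]; for a prime [pi] this says that [pi] does not
    divide [c], so that [c] is a unit of the localization. *)
Definition coprime_at c := forall x : R, dvdr pi (c * x) -> dvdr pi x.

Lemma coprime_at1 : coprime_at 1.
Proof. by move=> x; rewrite mul1r. Qed.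

Lemma coprime_at_neq0 c : coprime_at c -> c != 0.
Proof.
move=> uc; apply/eqP => c0; apply: pi_ndvd1; apply: uc.
by exists 0; rewrite c0 !mul0r.
Qed.

Lemma coprime_atM c c' : coprime_at c -> coprime_at c' -> coprime_at (c * c').
Proof. by move=> uc uc' x; rewrite -mulrA => /uc/uc'. Qed.

Lemma coprime_atMr a b : coprime_at (a * b) -> coprime_at b.
Proof. by move=> uab x dx; apply: uab; rewrite -mulrA; apply: dvdr_mull. Qed.

Lemma coprime_atX c k : coprime_at c -> coprime_at (c ^+ k).
Proof.
move=> uc; elim: k => [|k IHk]; first exact: coprime_at1.
by rewrite exprS; apply: coprime_atM.
Qed.

(** The factors [pi] are split off [x] one at a time, each being cancelled in the domain [R]. *)
Lemma coprime_at_dvdX c e x :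
  coprime_at c -> dvdr (pi ^+ e) (c * x) -> dvdr (pi ^+ e) x.
Proof.
move=> uc; elim: e x => [|e IHe] x [r def_r].
  by exists x; rewrite expr0 mulr1.
have [y def_x] : dvdr pi x by apply: uc; exists (r * pi ^+ e); rewrite -mulrA -exprSr.
have [z def_y] : dvdr (pi ^+ e) y.
  apply: IHe; exists r; apply: (mulIf pi_neq0).
  by rewrite -!mulrA -exprSr -def_r def_x.
by exists z; rewrite def_x def_y exprSr mulrA.
Qed.

Lemma dvdr_expE e f : dvdr (pi ^+ e) (pi ^+ f) <-> (e <= f)%N.
Proof.
split=> [[r def_r]|le_ef]; last by exists (pi ^+ (f - e)); rewrite -exprD subnK.
rewrite leqNgt; apply/negP => lt_fe; apply: pi_ndvd1.
exists (r * pi ^+ (e - f).-1); apply: (mulIf (expf_neq0 f pi_neq0)).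
rewrite mul1r {1}def_r -!mulrA -exprS -exprD addnS -addSn prednK ?subn_gt0 //.
by rewrite subnK // ltnW.
Qed.

(* N is obtained from M over the localization of R at pi. *)
Definition reduces m n m' n' (M : 'M[R]_(m, n)) (N : 'M[R]_(m', n')) :=
  exists c (P : 'M_(m', m)) (Q : 'M_(n, n')),
    coprime_at c /\ P *m M *m Q = c *: N.

Definition loc_equiv m n m' n' (M : 'M[R]_(m, n)) (N : 'M[R]_(m', n')) :=
  reduces M N /\ reduces N M.

(** The minors of order [k] of [c *: N = P *m M *m Q] are combinations of those of [M]; they are
    [c ^+ k] times those of [N], and [c ^+ k] cancels. *)
Lemma minors_dvd_reduces e k m n m' n' (M : 'M[R]_(m, n)) (N : 'M[R]_(m', n')) :
  reduces M N -> minors_dvd (pi ^+ e) k M -> minors_dvd (pi ^+ e) k N.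
Proof.
move=> [c [P [Q [uc def_N]]]] dM f g.
apply: (@coprime_at_dvdX (c ^+ k)); first exact: coprime_atX.
rewrite -detZ; have -> : c *: mxsub f g N = mxsub f g (c *: N).
  by apply/matrixP=> i j; rewrite !mxE.
by rewrite -def_N; apply/minors_dvd_mulr/minors_dvd_mull.
Qed.

Lemma minors_dvd_equiv e k m n m' n' (M : 'M[R]_(m, n)) (N : 'M[R]_(m', n')) :
  loc_equiv M N -> minors_dvd (pi ^+ e) k M <-> minors_dvd (pi ^+ e) k N.
Proof. by case=> MN NM; split; apply: minors_dvd_reduces. Qed.

Lemma reduces_mul m n m' n' (M : 'M[R]_(m, n)) (N : 'M[R]_(m', n'))
    (P : 'M_(m', m)) (Q : 'M_(n, n')) :
  P *m M *m Q = N -> reduces M N.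
Proof. by move=> <-; exists 1, P, Q; rewrite scale1r; split=> //; apply: coprime_at1. Qed.

Lemma reduces_trans m1 n1 m2 n2 m3 n3 (M1 : 'M[R]_(m1, n1)) (M2 : 'M[R]_(m2, n2))
    (M3 : 'M[R]_(m3, n3)) :
  reduces M1 M2 -> reduces M2 M3 -> reduces M1 M3.
Proof.
move=> [c [P [Q [uc def2]]]] [c' [P' [Q' [uc' def3]]]].
exists (c * c'), (P' *m P), (Q *m Q'); split; first exact: coprime_atM.
rewrite -!mulmxA (mulmxA M1) (mulmxA P) (mulmxA P) def2.
by rewrite -scalemxAl -scalemxAr mulmxA def3 scalerA.
Qed.

Lemma reduces_block m1 n1 m2 n2 m1' n1' m2' n2'
    (M1 : 'M[R]_(m1, n1)) (N1 : 'M[R]_(m1', n1'))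
    (M2 : 'M[R]_(m2, n2)) (N2 : 'M[R]_(m2', n2')) :
  reduces M1 N1 -> reduces M2 N2 ->
  reduces (block_mx M1 0 0 M2) (block_mx N1 0 0 N2).
Proof.
move=> [c [P [Q [uc def1]]]] [c' [P' [Q' [uc' def2]]]].
(* The cross factors bring both blocks to the common denominator [c * c']. *)
exists (c * c'), (block_mx (c' *: P) 0 0 (c *: P')), (block_mx Q 0 0 Q').
split; first exact: coprime_atM.
rewrite !mulmx_block !(mul0mx, mulmx0, addr0, add0r) -!scalemxAl def1 def2.
by rewrite !scalerA scale_block_mx !scaler0 [c' * c]mulrC.
Qed.

Lemma loc_equiv_refl m n (M : 'M[R]_(m, n)) : loc_equiv M M.
Proof. by split; apply: (@reduces_mul _ _ _ _ _ _ 1%:M 1%:M); rewrite mul1mx mulmx1. Qed.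

Lemma loc_equiv_trans m1 n1 m2 n2 m3 n3 (M1 : 'M[R]_(m1, n1))
    (M2 : 'M[R]_(m2, n2)) (M3 : 'M[R]_(m3, n3)) :
  loc_equiv M1 M2 -> loc_equiv M2 M3 -> loc_equiv M1 M3.
Proof. by move=> [? ?] [? ?]; split; apply: (@reduces_trans _ _ m2 n2 _ _ _ M2). Qed.

Lemma loc_equiv_block m1 n1 m2 n2 m1' n1' m2' n2'
    (M1 : 'M[R]_(m1, n1)) (N1 : 'M[R]_(m1', n1'))
    (M2 : 'M[R]_(m2, n2)) (N2 : 'M[R]_(m2', n2')) :
  loc_equiv M1 N1 -> loc_equiv M2 N2 ->
  loc_equiv (block_mx M1 0 0 M2) (block_mx N1 0 0 N2).
Proof. by move=> [? ?] [? ?]; split; apply: reduces_block. Qed.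

Lemma reduces_mxsub m n m' n' (M : 'M[R]_(m, n)) (f : 'I_m' -> 'I_m) (g : 'I_n' -> 'I_n) :
  reduces M (mxsub f g M).
Proof.
apply: (@reduces_mul _ _ _ _ _ _ (rowsub f 1%:M) (colsub g 1%:M)).
rewrite -mulmxA mul_rowsub_mx mul1mx mulmx_colsub mulmx1.
by apply/matrixP=> i j; rewrite !mxE.
Qed.

(** The adjugates invert [P] and [Q] up to their determinants, which are coprime to [pi]. *)
Lemma loc_equiv_mul n m (M N : 'M[R]_(m, n)) (P : 'M_m) (Q : 'M_n) c :
    coprime_at c -> coprime_at (\det P) -> coprime_at (\det Q) ->
  P *m M *m Q = c *: N -> loc_equiv M N.
Proof.
move=> uc uP uQ def_N; split; first by exists c, P, Q.
exists (\det P * \det Q), (c *: \adj P), (\adj Q); split; first exact: coprime_atM.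
rewrite -scalemxAl scalemxAr -def_N.
rewrite -!mulmxA mul_mx_adj !mulmxA mul_adj_mx.
by rewrite -mulmxA mul_scalar_mx mul_mx_scalar scalerA.
Qed.

(** Selecting the columns [f] and multiplying by their adjugate leaves a scalar coprime to [pi];
    conversely [M] is a multiple of the identity matrix. *)
Lemma loc_equiv_unit m n (M : 'M[R]_(m, n)) (f : 'I_m -> 'I_n) :
  coprime_at (\det (colsub f M)) -> loc_equiv M (1%:M : 'M_m).
Proof.
move=> uf; split; last by apply: (@reduces_mul _ _ _ _ _ _ 1%:M M); rewrite !mul1mx.
apply: reduces_trans (reduces_mxsub M id f) _.
by exists (\det (colsub f M)), (\adj (colsub f M)), 1%:M; rewrite mulmx1 mul_adj_mx scalemx1.
Qed.

Lemma reduces_tr m n m' n' (M : 'M[R]_(m, n)) (N : 'M[R]_(m', n')) :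
  reduces M N -> reduces M^T N^T.
Proof.
move=> [c [P [Q [uc def_N]]]]; exists c, Q^T, P^T; split=> //.
by rewrite -linearZ /= -def_N !trmx_mul mulmxA.
Qed.

Lemma loc_equiv_tr m n m' n' (M : 'M[R]_(m, n)) (N : 'M[R]_(m', n')) :
  loc_equiv M N -> loc_equiv M^T N^T.
Proof. by case=> ? ?; split; apply: reduces_tr. Qed.

(** Block elimination with the pivot [C], inverted up to [c] by its adjugate. [P] clears the lower
    left corner and [Q] the upper right one. *)
Lemma loc_equiv_schur k (C : 'M[R]_k) (x : 'cV_k) (y : 'rV_k) (z : 'M_1) :
  \det C != 0 -> coprime_at (\det C) ->
  loc_equiv (block_mx C x y z) (block_mx 1%:M 0 0 (\det (block_mx C x y z))%:M : 'M_(k + 1)).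
Proof.
move=> C_neq0 uC; set c := \det C in C_neq0 uC; set B := block_mx _ _ _ _.
pose P : 'M[R]_(k + 1) := block_mx 1%:M 0 (- (y *m \adj C)) c%:M.
pose Q : 'M[R]_(k + 1) := block_mx (\adj C) (- (\adj C *m x)) 0 c%:M.
pose s : 'M[R]_1 := c *: z - y *m \adj C *m x.
have PB : P *m B = block_mx C x 0 s.
  rewrite mulmx_block !mul1mx !mul0mx !addr0 !mul_scalar_mx !mulNmx.
  by rewrite -mulmxA mul_adj_mx mul_mx_scalar addNr addrC.
have detP : \det P = c by rewrite det_lblock det1 mul1r det_scalar1.
(* Taking determinants in [PB] gives [c * \det B = c * s 0 0], and [c] cancels. *)
have defs : s = (\det B)%:M.
  rewrite [s]mx11_scalar; congr (_%:M); apply: (mulfI C_neq0).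
  by rewrite -{2}detP -det_mulmx PB det_ublock det_mx11.
apply: (@loc_equiv_mul _ _ _ _ P Q c) => //; first by rewrite detP.
  rewrite det_ublock det_scalar1; apply: coprime_atM => //.
  (* The determinant of [\adj C] divides [c ^+ k], which is coprime to [pi]. *)
  apply: (@coprime_atMr (\det C)).
  by rewrite -det_mulmx mul_mx_adj det_scalar; apply: coprime_atX.
rewrite PB mulmx_block !mul0mx mulmx0 addr0 !add0r mul_mx_adj mulmxN mulmxA mul_mx_adj.
rewrite mul_scalar_mx mul_mx_scalar addNr mul_mx_scalar defs.
by rewrite scale_block_mx !scaler0 scalemx1 mulmx0.
Qed.

Definition diag_pi (s : seq nat) : 'M[R]_(size s) :=
  \matrix_(i, j) (pi ^+ nth 0%N s i *+ (i == j)).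

(** Both matrices have the same entries; only their dimensions [size s1 + size s2] and
    [size (s1 ++ s2)] need a cast. *)
Lemma loc_equiv_diag_cat s1 s2 :
  loc_equiv (block_mx (diag_pi s1) 0 0 (diag_pi s2)) (diag_pi (s1 ++ s2)).
Proof.
have e := size_cat s1 s2.
have D : block_mx (diag_pi s1) 0 0 (diag_pi s2) =
         mxsub (cast_ord (esym e)) (cast_ord (esym e)) (diag_pi (s1 ++ s2)).
  apply/matrixP=> i j; rewrite [RHS]mxE /diag_pi [RHS]mxE (inj_eq (@cast_ord_inj _ _ _)).
  rewrite nth_cat /=; case: (split_ordP i) => i' ->; case: (split_ordP j) => j' ->;
    rewrite ?block_mxEul ?block_mxEur ?block_mxEdl ?block_mxEdr !mxE /=
            ?eq_lshift ?eq_rshift ?eq_lrshift ?eq_rlshift ?ltn_ord //.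
  by rewrite addKn.
split; last by rewrite D; apply: reduces_mxsub.
have -> : diag_pi (s1 ++ s2) = mxsub (cast_ord e) (cast_ord e)
            (block_mx (diag_pi s1) 0 0 (diag_pi s2)).
  by rewrite D; apply/matrixP=> i j; rewrite [RHS]mxE [RHS]mxE !cast_ordK.
exact: reduces_mxsub.
Qed.

Lemma reduces_diag_perm s t : perm_eq s t -> reduces (diag_pi t) (diag_pi s).
Proof.
move=> /(perm_iotaP 0%N) [Is pI def_s].
have szI : size Is = size s by rewrite def_s size_map.
have ltI (i : 'I_(size s)) : (nth 0 Is i < size t)%N.
  have : nth 0%N Is i \in Is by rewrite mem_nth // szI.
  by rewrite (perm_mem pI) mem_iota.
suff -> : diag_pi s = mxsub (fun i => Ordinal (ltI i)) (fun i => Ordinal (ltI i)) (diag_pi t).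
  exact: reduces_mxsub.
apply/matrixP=> i j; rewrite !mxE; congr (_ ^+ _ *+ _).
  by rewrite {1}def_s (nth_map 0%N) // szI.
rewrite -!val_eqE /= nth_uniq ?szI //.
by rewrite (perm_uniq pI) iota_uniq.
Qed.

Lemma loc_equiv_diag_sort s : loc_equiv (diag_pi s) (diag_pi (sort leq s)).
Proof. by split; apply: reduces_diag_perm; rewrite ?perm_sort // perm_sym perm_sort. Qed.

Lemma diag_pi_nseq0 n : loc_equiv (1%:M : 'M_n) (diag_pi (nseq n 0%N)).
Proof.
have e := size_nseq n 0%N.
have D : diag_pi (nseq n 0%N) = mxsub (cast_ord e) (cast_ord e) 1%:M.
  apply/matrixP=> i j; rewrite !mxE (inj_eq (@cast_ord_inj _ _ _)).
  by rewrite nth_nseq if_same.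
split; first by rewrite D; apply: reduces_mxsub.
have -> : 1%:M = mxsub (cast_ord (esym e)) (cast_ord (esym e)) (diag_pi (nseq n 0%N)).
  by rewrite D; apply/matrixP=> i j; rewrite [RHS]mxE [RHS]mxE !cast_ordKV.
exact: reduces_mxsub.
Qed.

(** After a cyclic shift of the columns the entries [b] form the diagonal of a corner of order [n]
    and determinant [b ^+ n]. The Schur complement with respect to this corner is the whole
    determinant, [pi ^+ n.+1] up to sign. *)
Lemma loc_equiv_bidiag b n : coprime_at b ->
  loc_equiv (bidiag pi b n.+1) (diag_pi (nseq n 0%N ++ [:: n.+1])).
Proof.
move=> ub; suff: loc_equiv (bidiag pi b (n + 1)) (diag_pi (nseq n 0%N ++ [:: n.+1])).
  by rewrite addn1.
(* [ordS] is the cyclic successor, so the first column moves to the last place. *)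
pose B := colsub (@ordS (n + 1)) (bidiag pi b (n + 1)).
have equivB : loc_equiv (bidiag pi b (n + 1)) B.
  split; first exact: reduces_mxsub.
  have -> : bidiag pi b (n + 1) = colsub (@ord_pred (n + 1)) B.
    by apply/matrixP=> i j; rewrite [RHS]mxE [RHS]mxE ord_predK.
  exact: reduces_mxsub.
have detB : \det B = (-1) ^+ perm (@ordS_inj (n + 1)) * pi ^+ n.+1.
  have -> : B = col_perm (perm (@ordS_inj (n + 1))) (bidiag pi b (n + 1)).
    by apply/matrixP=> i j; rewrite !mxE permE.
  by rewrite col_permE det_mulmx det_bidiag det_perm odd_permV mulrC addn1.
have detC : \det (ulsubmx B) = b ^+ n.
  rewrite -det_tr -(det_bidiag b pi); congr (\det _); apply/matrixP=> i j.
  rewrite !mxE /= modn_small ?eqSS 1?addrC 1?[j == i :> nat]eq_sym //.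
  by rewrite addn1 ltnS ltn_ord.
apply: loc_equiv_trans equivB _.
rewrite -[B]submxK; apply: loc_equiv_trans (loc_equiv_schur _ _ _ _ _) _.
- by rewrite detC expf_neq0 // coprime_at_neq0.
- by rewrite detC; apply: coprime_atX.
rewrite submxK detB; apply: loc_equiv_trans (loc_equiv_diag_cat _ _).
apply: loc_equiv_block; first exact: diag_pi_nseq0.
(* The sign of the cyclic permutation is its own inverse and is absorbed on the left. *)
set e := (X in (-1) ^+ X); apply: (@loc_equiv_mul _ _ _ _ ((-1) ^+ e)%:M 1%:M 1).
- exact: coprime_at1.
- rewrite det_scalar1; apply: (@coprime_atMr ((-1) ^+ e)).
  by rewrite -expr2 sqrr_sign; apply: coprime_at1.
- by rewrite det1; apply: coprime_at1.
rewrite mulmx1 mul_scalar_mx scale1r scale_scalar_mx mulrA -expr2 sqrr_sign mul1r.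
by apply/matrixP=> i j; rewrite !mxE !ord1.
Qed.

End LocalEquivalence.

(** * Sums of the smallest entries of a sorted sequence *)

Lemma leq_sum_exchange (T : finType) (A B : {set T}) (w : T -> nat) (tau : nat) :
    #|A| = #|B| ->
    (forall x, x \in A :\: B -> (w x <= tau)%N) ->
    (forall x, x \in B :\: A -> (tau <= w x)%N) ->
  (\sum_(x in A) w x <= \sum_(x in B) w x)%N.
Proof.
move=> eqAB wA wB; rewrite (big_setID B) [leqRHS](big_setID A) /= setIC.
rewrite leq_add2l.
have eqD : #|A :\: B| = #|B :\: A|.
  by apply/eqP; rewrite -(eqn_add2l #|A :&: B|) cardsID setIC cardsID eqAB.
apply: (@leq_trans (#|A :\: B| * tau)%N).
  by rewrite -sum_nat_const; apply: leq_sum.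
by rewrite eqD -sum_nat_const; apply: leq_sum.
Qed.

Lemma sorted_sum_inj (s : seq nat) j (f : 'I_j -> 'I_(size s)) :
    sorted leq s -> (j <= size s)%N -> injective f ->
  (\sum_(i < j) nth 0 s i <= \sum_(i < j) nth 0 s (f i))%N.
Proof.
move=> s_sorted le_j f_inj.
have sums (g : 'I_j -> 'I_(size s)) : injective g ->
    (\sum_(i < j) nth 0 s (g i) = \sum_(x in g @: setT) nth 0 s x)%N.
  by move=> g_inj; rewrite big_imset /=; [apply: eq_bigl => i; rewrite inE | apply: in2W].
have w_inj : injective (widen_ord le_j) by move=> x y [/val_inj].
rewrite -(eq_bigr (fun i => nth 0 s (widen_ord le_j i)) (fun i _ => erefl)) !sums //.
have le_nth := sorted_leq_nth leq_trans leqnn 0%N s_sorted.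
(* The threshold is the last of the first [j] entries: positions below [j] carry at most it, the
   others at least it. For [j = 0] both sets are empty. *)
apply: (@leq_sum_exchange _ _ _ _ (nth 0%N s j.-1)).
- by rewrite !card_imset.
- move=> x /setDP[/imsetP[i _ ->] _] /=.
  case: j i {f_inj sums w_inj f} le_j => [[]|j] // i le_j.
  by apply: le_nth; rewrite ?inE ?(leq_trans (ltn_ord i)) // -ltnS.
move=> x /setDP[_ /imsetP xP].
have le_jx : (j <= x)%N.
  rewrite leqNgt; apply/negP => lt_xj; case: xP.
  by exists (Ordinal lt_xj); rewrite ?inE //; apply: val_inj.
apply: le_nth; rewrite ?inE //; last exact: leq_trans (leq_pred _) le_jx.
exact: leq_ltn_trans (leq_trans (leq_pred _) le_jx) (ltn_ord x).
Qed.

(** If one of the first [j] entries exceeds 1, then so do all entries from position [j] on; these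
    already use up [size s - j] of the total. *)
Lemma sorted_sum_le (s : seq nat) j :
    sorted leq s -> (j <= size s)%N -> (sumn s <= size s)%N ->
  (\sum_(i < j) nth 0 s i <= j)%N.
Proof.
move=> s_sorted le_j le_s.
have [le1|/forallPn[i0]] := boolP [forall i : 'I_j, (nth 0 s i <= 1)%N].
  rewrite -[leqRHS]card_ord -sum1_card; apply: leq_sum => i _.
  exact: (forallP le1).
rewrite -ltnNge => gt1.
have le_nth := sorted_leq_nth leq_trans leqnn 0%N s_sorted.
rewrite -(leq_add2r (size s - j)) subnKC //; apply: leq_trans le_s.
rewrite sumnE (big_nth 0%N) (big_cat_nat (n := j)) //= big_mkord leq_add2l.
rewrite -[leqLHS]muln1 -sum_nat_const_nat big_nat_cond [leqRHS]big_nat_cond.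
apply: leq_sum => i /andP[/andP[le_ji lt_i] _].
apply: (leq_trans (ltnW gt1)); apply: le_nth; rewrite ?inE ?(leq_trans _ le_ji) //.
  by rewrite (leq_trans (ltn_ord i0)).
exact: ltnW.
Qed.

(** * Minors of a diagonal matrix of powers of [pi] *)

Section DiagonalMinors.
Variables (R : idomainType) (pi : R).
Hypotheses (pi_neq0 : pi != 0) (pi_ndvd1 : ~ dvdr pi 1).

(** The leading principal minor attains the bound. In any other minor with distinct rows, each term
    of the expansion is a multiple of the product of the powers of [pi] in these rows. *)
Lemma minors_dvd_diag (s : seq nat) e j : sorted leq s -> (j <= size s)%N ->
  minors_dvd (pi ^+ e) j (diag_pi pi s) <-> (e <= \sum_(i < j) nth 0 s i)%N.
Proof.
move=> s_sorted le_j; split=> [dM|le_e f g].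
  have := dM (widen_ord le_j) (widen_ord le_j).
  have -> : mxsub (widen_ord le_j) (widen_ord le_j) (diag_pi pi s) =
            diag_mx (\row_i pi ^+ nth 0%N s i).
    apply/matrixP=> i k; rewrite !mxE -!val_eqE /=.
    by have [/val_inj->|] := eqVneq (i : nat) k.
  rewrite det_diag; under eq_bigr => i _ do rewrite mxE.
  by rewrite -expr_sum => /(dvdr_expE pi_neq0 pi_ndvd1).
have [/injectiveP f_inj|/injectivePn[x [y neq_xy eq_f]]] := boolP (injectiveb f); last first.
  rewrite (determinant_alternate neq_xy) => [|i]; last by rewrite !mxE eq_f.
  by exists 0; rewrite mul0r.
apply: dvdr_sum => t; apply: dvdr_mull.
under eq_bigr => i _ do rewrite mxE mxE -mulr_natr.
rewrite big_split /= mulrC; apply: dvdr_mull; rewrite -expr_sum.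
apply/(dvdr_expE pi_neq0 pi_ndvd1)/(leq_trans le_e).
exact: sorted_sum_inj.
Qed.

End DiagonalMinors.

(** * From a local Smith form to determinantal divisors and partial multiplicities *)

Section DeterminantalDivisors.
Variable F : fieldType.
Implicit Type lam : option F.

(* The residue map modulo [lin_form lam]. *)
Definition lin_eval lam (P : {poly {poly F}}) : {poly F} :=
  match lam with
  | Some l => P.[l%:P * 'X]
  | None => map_poly (horner_eval 0) P
  end.

Lemma lin_evalM lam P Q : lin_eval lam (P * Q) = lin_eval lam P * lin_eval lam Q.
Proof. by case: lam => [l|] /=; rewrite ?hornerM ?rmorphM. Qed.

Lemma dvdr_lin_form lam P : dvdr (lin_form lam) P <-> lin_eval lam P = 0.
Proof.
case: lam => [l|] /=.
  split=> [[r ->]|/eqP/factor_theorem[r ->]]; last by exists r.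
  by rewrite hornerM hornerXsubC subrr mulr0.
split=> [[r ->]|P0].
  by rewrite rmorphM /= map_polyC /= /horner_eval hornerX mulr0.
(* At infinity the form is the inner variable [t]; each coefficient of [P] vanishes at 0, so the
   quotient is taken coefficientwise. *)
exists (map_poly (fun p => p %/ 'X) P); apply/polyP=> i.
rewrite coefMC coef_map_id0 ?div0p // divpK //.
move/polyP/(_ i): P0; rewrite coef_map coef0 /= /horner_eval => /eqP.
by rewrite -[_ == 0]/(root _ 0) -dvdp_XsubCl subr0.
Qed.

Lemma lin_form_neq0 lam : lin_form lam != 0.
Proof. by case: lam => [l|] /=; rewrite ?polyXsubC_eq0 // polyC_eq0 polyX_eq0. Qed.

Lemma lin_form_ndvd1 lam : ~ dvdr (lin_form lam) 1.
Proof.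
move/dvdr_lin_form => /eqP; apply/negP.
by case: lam => [l|] /=; rewrite ?hornerC ?rmorph1 oner_neq0.
Qed.

Lemma coprime_lin_form lam c : lin_eval lam c != 0 -> coprime_at (lin_form lam) c.
Proof.
move=> c_neq0 x /dvdr_lin_form/eqP; rewrite lin_evalM mulf_eq0 (negPf c_neq0).
by move/eqP/dvdr_lin_form.
Qed.

Lemma bigmax_prefix (P : pred nat) k m : (m <= k)%N ->
  (forall e, P e = (e <= m)%N) -> (\max_(e < k.+1 | P e) e)%N = m.
Proof.
move=> le_mk PE; apply/eqP; rewrite eqn_leq; apply/andP; split.
  by apply/bigmax_leqP => e; rewrite PE.
have lt_m : (m < k.+1)%N by [].
by apply: (bigop.bigmax_sup (Ordinal lt_m)) => //=; rewrite PE.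
Qed.

Variables (p q : nat) (A0 A1 : 'M[F]_(p, q)) (lam : option F) (s : seq nat).
Hypotheses (s_sorted : sorted leq s) (sum_s : (sumn s <= size s)%N)
  (equiv_s : loc_equiv (lin_form lam) (hom_pencil A0 A1) (diag_pi (lin_form lam) s)).

(** By [sum_s] the sum is at most [j], hence inside the range of the maximum that defines
    [detdiv_exp]. *)
Lemma detdiv_expE j : (j <= size s)%N ->
  detdiv_exp A0 A1 lam j = (\sum_(i < j) nth 0 s i)%N.
Proof.
move=> le_j; apply: (@bigmax_prefix
  (fun e => `[< minors_dvd (lin_form lam ^+ e) j (hom_pencil A0 A1) >])).
  exact: sorted_sum_le.
move=> e; apply/asboolP/idP.
  move/(minors_dvd_equiv (lin_form_neq0 lam) e j equiv_s).
  by move/(minors_dvd_diag (lin_form_neq0 lam) (@lin_form_ndvd1 lam) e s_sorted le_j).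
move/(minors_dvd_diag (lin_form_neq0 lam) (@lin_form_ndvd1 lam) e s_sorted le_j).
by move/(minors_dvd_equiv (lin_form_neq0 lam) e j equiv_s).
Qed.

Hypothesis rank_s : pencil_rank A0 A1 = size s.

(** Consecutive determinantal exponents differ by one entry of [s]. Partial multiplicities are
    numbered from the largest, whereas [s] is nondecreasing, hence the reversed position. *)
Lemma part_multE i : (i < size s)%N ->
  part_mult A0 A1 lam i.+1 = nth 0%N s (size s - i.+1).
Proof.
move=> lt_i; rewrite /part_mult /hinv_exp rank_s; set j := (size s - i.+1)%N.
have lt_j : (j < size s)%N by rewrite ltn_subrL (leq_ltn_trans _ lt_i).
by rewrite /= !detdiv_expE // 1?ltnW // big_ord_recr /= addKn.
Qed.

Lemma wRE k : wR A0 A1 lam k = count (leq k) s.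
Proof.
rewrite /wR -sum1dep_card.
rewrite -(big_mkord (fun i => k <= part_mult A0 A1 lam i.+1)%N (fun _ => 1%N)) rank_s.
rewrite big_nat_rev /= -sum1_count [RHS](big_nth 0%N) big_nat_cond [RHS]big_nat_cond.
apply: eq_bigl => i; rewrite add0n; have [lt_i|] := ltnP i (size s) => //=.
rewrite part_multE; first by rewrite subnSK // subKn // ltnW.
by rewrite ltn_subrL (leq_ltn_trans _ lt_i).
Qed.

End DeterminantalDivisors.

(** * Evaluation of pencils and of Kronecker blocks *)

Section PencilEvaluation.
Variables (F : fieldType) (S : comNzRingType) (phi : {rmorphism F -> S}) (x y : S).

(** One formula for three uses: [(x, y)] is [(t, s)] for the homogeneous pencil, [(1, s)] over the
    fraction field, and the homogeneous coordinates of [lam] over [F]. *)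
Definition pencil_at p q (A0 A1 : 'M[F]_(p, q)) : 'M[S]_(p, q) :=
  x *: map_mx phi A0 + y *: map_mx phi A1.

Lemma pencil_at_mul p q p' q' (P : 'M[F]_(p', p)) (Q : 'M[F]_(q, q')) A0 A1 :
  pencil_at (P *m A0 *m Q) (P *m A1 *m Q) =
  map_mx phi P *m pencil_at A0 A1 *m map_mx phi Q.
Proof. by rewrite /pencil_at !map_mxM mulmxDr mulmxDl -!scalemxAr -!scalemxAl. Qed.

Lemma pencil_at_block p q p' q' (A0 A1 : 'M[F]_(p, q)) (B0 B1 : 'M[F]_(p', q')) :
  pencil_at (block_mx A0 0 0 B0) (block_mx A1 0 0 B1) =
  block_mx (pencil_at A0 A1) 0 0 (pencil_at B0 B1).
Proof.
by rewrite /pencil_at !map_block_mx !map_mx0 !scale_block_mx !scaler0 add_block_mx !addr0.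
Qed.

Definition kblock_at (b : kblock F) := pencil_at (b0 (kblk b)) (b1 (kblk b)).

Lemma kblock_at_KJ mu k : kblock_at (KJ mu k) = bidiag (y - phi mu * x) x k.
Proof.
apply/matrixP=> i j; rewrite !mxE rmorphB rmorphM !rmorph_nat /=.
by case: (_ == _ :> nat); case: (_ == _ :> nat); ring.
Qed.

Lemma kblock_at_KN k : kblock_at (KN F k) = bidiag x y k.
Proof. by apply/matrixP=> i j; rewrite !mxE !rmorph_nat /= !mulr_natr. Qed.

Lemma kblock_at_KLT k : kblock_at (KLT F k) = (kblock_at (KL F k))^T.
Proof. by apply/matrixP=> i j; rewrite !mxE. Qed.

(** Deleting the first column of [L_k] gives a minor [x ^+ k], and deleting the last one gives
    [y ^+ k]; at each point of the projective line one of the two is usable. *)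
Lemma kblock_at_KL_lift k :
  colsub (lift ord0) (kblock_at (KL F k)) = (bidiag x y k)^T.
Proof.
by apply/matrixP=> i j; rewrite !mxE !rmorph_nat /= !mulr_natr eqSS [i == j.+1 :> nat]eq_sym.
Qed.

Lemma kblock_at_KL_widen k :
  colsub (widen_ord (leqnSn k)) (kblock_at (KL F k)) = bidiag y x k.
Proof.
by apply/matrixP=> i j; rewrite !mxE !rmorph_nat /= !mulr_natr addrC [j == i :> nat]eq_sym.
Qed.

End PencilEvaluation.

(** * The local Smith form of a Kronecker canonical form *)

Section LocalSmithForm.
Variables (F : fieldType) (lam : option F).
Notation pi := (lin_form lam).
Let polyC2 : {rmorphism F -> {poly {poly F}}} := polyC \o polyC.

Lemma hom_pencilE p q (A0 A1 : 'M[F]_(p, q)) :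
  hom_pencil A0 A1 = pencil_at polyC2 'X%:P 'X A0 A1.
Proof. by apply/matrixP=> i j; rewrite !mxE /= ['X%:P * _]mulrC ['X * _]mulrC. Qed.

(** The guard [0 < k] keeps the list empty for an empty block, so that its length is always [k]. *)
Definition jordan_exps (mu : option F) k : seq nat :=
  if (mu == lam) && (0 < k)%N then nseq k.-1 0%N ++ [:: k] else nseq k 0%N.

(** Zero exponents are kept, so the length of the list is the rank of the block for every [lam]. *)
Definition kblock_exps (b : kblock F) : seq nat :=
  match b with
  | KL k | KLT k => nseq k 0%N
  | KJ mu k => jordan_exps (Some mu) k
  | KN k => jordan_exps None k
  end.

Definition kcf_exps (kb : seq (kblock F)) := flatten (map kblock_exps kb).

(** Modulo [lin_form lam], the form at [mu] becomes a nonzero multiple of [t] when [lam] is finite,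
    and [s] when [lam] is infinite. *)
Lemma coprime_lin_form_neq mu : mu != lam -> coprime_at pi (lin_form mu).
Proof.
move=> neq; apply: coprime_lin_form; move: neq.
case: mu lam => [m|] [l|] //= neq.
- rewrite hornerXsubC -mulrBl mulf_neq0 ?polyX_eq0 // -polyCB polyC_eq0 subr_eq0.
  by apply: contraNneq neq => ->.
- rewrite rmorphB /= map_polyX map_polyC /= /horner_eval hornerM hornerX mulr0 subr0.
  by rewrite polyX_eq0.
by rewrite hornerC polyX_eq0.
Qed.

(** The superdiagonal entry of a homogenized Jordan block at [mu]: [t] for a finite eigenvalue, [s]
    for the infinite one. *)
Definition cofactor_var (mu : option F) : {poly {poly F}} :=
  if mu is Some _ then 'X%:P else 'X.

Lemma coprime_cofactor_var : coprime_at pi (cofactor_var lam).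
Proof.
apply: coprime_lin_form; case: lam => [l|] /=; first by rewrite hornerC polyX_eq0.
by rewrite map_polyX polyX_eq0.
Qed.

Lemma loc_equiv_jordan mu k :
  loc_equiv pi (bidiag (lin_form mu) (cofactor_var mu) k) (diag_pi pi (jordan_exps mu k)).
Proof.
rewrite /jordan_exps; have [->|neq] := eqVneq mu lam.
  case: k => [|k]; last first.
    exact (loc_equiv_bidiag (@lin_form_ndvd1 _ lam) k coprime_cofactor_var).
  by rewrite [bidiag _ _ _]flatmx0 [diag_pi _ _]flatmx0; apply: loc_equiv_refl.
apply: loc_equiv_trans (diag_pi_nseq0 _ _); apply: (@loc_equiv_unit _ _ _ _ _ id).
rewrite (_ : colsub _ _ = bidiag (lin_form mu) (cofactor_var mu) k); last first.
  by apply/matrixP=> i j; rewrite !mxE.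
by rewrite det_bidiag; apply/coprime_atX/coprime_lin_form_neq.
Qed.

Lemma loc_equiv_KL k :
  loc_equiv pi (kblock_at polyC2 'X%:P 'X (KL F k)) (1%:M : 'M_k).
Proof.
case def_lam: lam => [l|].
  apply: (@loc_equiv_unit _ _ _ _ _ (lift ord0)).
  rewrite kblock_at_KL_lift det_tr det_bidiag -def_lam; apply: coprime_atX.
  by have := coprime_cofactor_var; rewrite {2}def_lam.
apply: (@loc_equiv_unit _ _ _ _ _ (widen_ord (leqnSn k))).
rewrite kblock_at_KL_widen det_bidiag -def_lam; apply: coprime_atX.
by have := coprime_cofactor_var; rewrite {2}def_lam.
Qed.

Lemma loc_equiv_kblock b :
  loc_equiv pi (kblock_at polyC2 'X%:P 'X b) (diag_pi pi (kblock_exps b)).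
Proof.
case: b => [k|k|mu k|k] /=.
- exact: loc_equiv_trans (loc_equiv_KL k) (diag_pi_nseq0 _ _).
- rewrite kblock_at_KLT; apply: loc_equiv_trans (diag_pi_nseq0 _ _).
  by rewrite -[1%:M]trmx1; apply/loc_equiv_tr/loc_equiv_KL.
- have := loc_equiv_jordan (Some mu) k.
  by rewrite kblock_at_KJ /= -polyCM.
by rewrite kblock_at_KN; apply: (loc_equiv_jordan None k).
Qed.

Lemma loc_equiv_dsum kb :
  loc_equiv pi (hom_pencil (dsum0 (map (@kblk F) kb)) (dsum1 (map (@kblk F) kb)))
    (diag_pi pi (kcf_exps kb)).
Proof.
elim: kb => [|b kb IHkb].
  by rewrite [hom_pencil _ _]flatmx0 [diag_pi _ _]flatmx0; apply: loc_equiv_refl.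
rewrite hom_pencilE /= pencil_at_block.
apply: loc_equiv_trans (loc_equiv_diag_cat _ _ _).
apply: loc_equiv_block; first exact: loc_equiv_kblock.
by rewrite -hom_pencilE.
Qed.

Lemma loc_equiv_strict p q (A0 A1 : 'M[F]_(p, q)) P Q :
    P \in unitmx -> Q \in unitmx ->
  loc_equiv pi (hom_pencil A0 A1) (hom_pencil (P *m A0 *m Q) (P *m A1 *m Q)).
Proof.
have unitP n (U : 'M[F]_n) : U \in unitmx -> coprime_at pi (\det (map_mx polyC2 U)).
  rewrite unitmxE unitfE det_map_mx => nzU; apply: coprime_lin_form.
  by case: lam => [l|] /=; rewrite ?hornerC ?map_polyC /= /horner_eval ?hornerC polyC_eq0.
move=> uP uQ; apply: (@loc_equiv_mul _ _ _ _ _ _ (map_mx polyC2 P) (map_mx polyC2 Q) 1).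
- exact: coprime_at1.
- exact: unitP.
- exact: unitP.
by rewrite scale1r !hom_pencilE pencil_at_mul.
Qed.

Lemma size_kblock_exps b :
  size (kblock_exps b) =
  match b with KL k | KLT k | KJ _ k | KN k => k end.
Proof.
have szJ mu k : size (jordan_exps mu k) = k.
  rewrite /jordan_exps; case: ifP => [/andP[_ k_gt0]|_]; last by rewrite size_nseq.
  by rewrite size_cat size_nseq addn1 prednK.
by case: b => [k|k|mu k|k] /=; rewrite ?size_nseq.
Qed.

Lemma sumn_kcf_exps kb : (sumn (kcf_exps kb) <= size (kcf_exps kb))%N.
Proof.
elim: kb => //= b kb IHkb; rewrite sumn_cat size_cat leq_add // size_kblock_exps.
have sumJ mu k : (sumn (jordan_exps mu k) <= k)%N.
  by rewrite /jordan_exps; case: ifP => _; rewrite ?sumn_cat sumn_nseq //= addn0.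
by case: b => [k|k|mu k|k] //=; rewrite sumn_nseq.
Qed.

End LocalSmithForm.

(** * The rank of a pencil over the field of rational functions *)

Section PencilRank.
Variable F : fieldType.
Let phi : {rmorphism F -> {fraction {poly F}}} := (@FracField.tofrac {poly F}) \o polyC.

Lemma pencil_fracE p q (A0 A1 : 'M[F]_(p, q)) :
  pencil_frac A0 A1 = pencil_at phi 1 (FracField.tofrac 'X) A0 A1.
Proof. by apply/matrixP=> i j; rewrite !mxE /= rmorphD rmorphM mul1r [X in _ + X]mulrC. Qed.

Lemma mxrank_colsub_unit (K : fieldType) m n (M : 'M[K]_(m, n)) f :
  \det (colsub f M) != 0 -> \rank M = m.
Proof.
move=> nz; apply/eqP; rewrite eqn_leq rank_leq_row /=.
have /mxrank_unit {1}<- : colsub f M \in unitmx by rewrite unitmxE unitfE.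
have -> : colsub f M = M *m colsub f 1%:M by rewrite mulmx_colsub mulmx1.
exact: mxrankM_maxl.
Qed.

Lemma pencil_rank_kblock b :
  \rank (kblock_at phi 1 (FracField.tofrac 'X) b) =
  match b with KL k | KLT k | KJ _ k | KN k => k end.
Proof.
have rkL k : \rank (kblock_at phi 1 (FracField.tofrac 'X) (KL F k)) = k.
  apply: (@mxrank_colsub_unit _ _ _ _ (lift ord0)).
  by rewrite kblock_at_KL_lift det_tr det_bidiag expr1n oner_neq0.
case: b => [k|k|mu k|k] //=.
- exact: rkL.
- by rewrite kblock_at_KLT mxrank_tr; apply: rkL.
- apply/mxrank_unit; rewrite kblock_at_KJ unitmxE unitfE det_bidiag mulr1.
  by rewrite -rmorphB expf_neq0 // tofrac_eq0 polyXsubC_eq0.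
apply/mxrank_unit; rewrite kblock_at_KN unitmxE det_bidiag expr1n.
exact: unitr1.
Qed.

Lemma pencil_rank_dsum lam kb :
  pencil_rank (dsum0 (map (@kblk F) kb)) (dsum1 (map (@kblk F) kb)) = size (kcf_exps lam kb).
Proof.
elim: kb => [|b kb IHkb]; first by rewrite /pencil_rank [pencil_frac _ _]flatmx0 mxrank0.
rewrite /pencil_rank pencil_fracE /= pencil_at_block rank_diag_block_mx.
rewrite -[pencil_at _ _ _ _ _]/(kblock_at _ _ _ b) pencil_rank_kblock.
by rewrite -pencil_fracE size_cat size_kblock_exps -IHkb.
Qed.

Lemma pencil_rank_strict p q (A0 A1 : 'M[F]_(p, q)) P Q :
    P \in unitmx -> Q \in unitmx ->
  pencil_rank (P *m A0 *m Q) (P *m A1 *m Q) = pencil_rank A0 A1.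
Proof.
move=> uP uQ; rewrite /pencil_rank !pencil_fracE pencil_at_mul.
rewrite mxrankMfree ?row_free_unit ?map_unitmx //.
by rewrite eqmxMfull // row_full_unit map_unitmx.
Qed.

End PencilRank.

(** * Dimensions of subspaces given by predicates *)

Section SubspaceDimension.
Variable F : fieldType.

(** A subspace of column vectors is represented by the row space of [B], through transposition. *)
Definition has_dim n (S : 'cV[F]_n -> Prop) d :=
  exists m (B : 'M[F]_(m, n)), (forall v, S v <-> (v^T <= B)%MS) /\ \rank B = d.

Lemma has_dim_ext n (S T : 'cV[F]_n -> Prop) d :
  (forall v, T v <-> S v) -> has_dim S d -> has_dim T d.
Proof.
move=> TS [m [B [SB rkB]]]; exists m, B; split=> // v.
by split=> [/TS/SB | /SB/TS].
Qed.

Lemma has_dim_unit n (S : 'cV[F]_n -> Prop) (G : 'M_n) d :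
  G \in unitmx -> has_dim S d -> has_dim (fun v => S (G *m v)) d.
Proof.
move=> uG [m [B [SB rkB]]]; exists m, (B *m invmx G^T).
have uGt : G^T \in unitmx by rewrite unitmx_tr.
split; last by rewrite mxrankMfree // row_free_unit unitmx_inv.
move=> v; rewrite (_ : _ <= _ = ((G *m v)^T <= B))%MS //.
by rewrite -[in LHS](mulmxK uGt v^T) submxMfree ?trmx_mul // row_free_unit unitmx_inv.
Qed.

Lemma has_dim_dsum n1 n2 (S1 : 'cV[F]_n1 -> Prop) (S2 : 'cV[F]_n2 -> Prop) d1 d2 :
  has_dim S1 d1 -> has_dim S2 d2 ->
  has_dim (fun v : 'cV_(n1 + n2) => S1 (usubmx v) /\ S2 (dsubmx v)) (d1 + d2).
Proof.
move=> [m1 [B1 [SB1 rk1]]] [m2 [B2 [SB2 rk2]]].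
exists (m1 + m2)%N, (block_mx B1 0 0 B2); split; last by rewrite rank_diag_block_mx rk1 rk2.
move=> v; rewrite -{3}[v]vsubmxK tr_col_mx; split.
  move=> [/SB1/submxP[w1 ->] /SB2/submxP[w2 ->]].
  apply/submxP; exists (row_mx w1 w2).
  by rewrite mul_row_block !mulmx0 addr0 add0r.
case/submxP=> w; rewrite -[w]hsubmxK mul_row_block !mulmx0 addr0 add0r.
by case/eq_row_mx => e1 e2; split; [apply/SB1 | apply/SB2]; rewrite ?e1 ?e2 submxMl.
Qed.

Lemma has_dim0 n : has_dim (fun v : 'cV[F]_n => v = 0) 0.
Proof.
exists n, 0; split; last by rewrite mxrank0.
by move=> v; rewrite submx0 trmx_eq0; split=> /eqP.
Qed.

(** The set [S] may miss the zero vector of the subspace [T]; a basis of [T] still lies in [S],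
    since basis vectors are nonzero. *)
Lemma span_dimE n (S T : 'cV[F]_n -> Prop) d :
    (forall v, S v -> T v) -> (forall v, T v -> v != 0 -> S v) ->
  has_dim T d -> span_dim S = d.
Proof.
move=> ST TS [m [B [TB rkB]]].
pose X : (\rank B).-tuple 'cV[F]_n := [tuple (row i (row_base B))^T | i < \rank B].
have combX (w : 'rV_(\rank B)) : \sum_i w 0 i *: X`_i = (w *m row_base B)^T.
  rewrite mulmx_sum_row linear_sum; apply: eq_bigr => i _.
  by rewrite linearZ -(tnth_nth 0 X) tnth_mktuple.
have freeX : free X.
  apply/freeP => k; have := combX (\row_i k i); under eq_bigr => i _ do rewrite mxE.
  move=> -> /eqP; rewrite trmx_eq0 mulmx_free_eq0 ?row_base_free // => /eqP/rowP k0 i.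
  by have := k0 i; rewrite !mxE.
have TX v : T v <-> v \in <<X>>%VS.
  rewrite TB -(eq_row_base B); split=> [/submxP[w def_v]|/coord_span def_v].
    rewrite -[v]trmxK def_v -combX; apply: memv_suml => i _; apply: memvZ.
    by apply: memv_span; rewrite mem_nth ?size_tuple.
  rewrite def_v; apply/submxP; exists (\row_i coord X i v).
  apply: trmx_inj; rewrite -combX trmxK; apply: eq_bigr => i _; rewrite mxE //.
have dimX : \dim <<X>> = d by rewrite -rkB; have /eqnP -> := freeX; rewrite size_tuple.
have le_dn : (d <= n)%N by rewrite -rkB rank_leq_col.
apply/eqP; rewrite eqn_leq; apply/andP; split.
  apply/bigmax_leqP => k /asboolP[Y [SY <-]]; rewrite -dimX; apply: dimvS.
  by apply/span_subvP => y /SY/ST/TX.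
have lt_d : (d < n.+1)%N by [].
apply: (bigop.bigmax_sup (Ordinal lt_d)) => //=; apply/asboolP; exists X; split=> // x Xx.
apply: TS; first by apply/TX/memv_span.
exact: free_not0 freeX Xx.
Qed.

(** Coordinates indexed by all natural numbers, zero out of range, so that shifts need no special
    case at the border. *)
Definition coordn n (v : 'cV[F]_n) m : F := if insub m is Some j then v j 0 else 0.

Lemma coordnE n (v : 'cV[F]_n) (i : 'I_n) : coordn v i = v i 0.
Proof. by rewrite /coordn valK. Qed.

Lemma coordn_ge n (v : 'cV[F]_n) m : (n <= m)%N -> coordn v m = 0.
Proof. by move=> le_nm; rewrite /coordn insubN // -leqNgt. Qed.

Lemma coordn_col n (f : nat -> F) m : (m < n)%N -> coordn (\col_(i < n) f i) m = f m.
Proof. by move=> lt_mn; rewrite -[m]/(val (Ordinal lt_mn)) coordnE mxE. Qed.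

Lemma sum_delta n a (f : nat -> F) :
  \sum_(j < n) (j == a :> nat)%:R * f j = f a *+ (a < n)%N.
Proof.
have [lt_an|le_na] := ltnP a n; last first.
  by rewrite big1 // => j _; rewrite ltn_eqF ?mul0r //; apply: leq_trans le_na.
rewrite (bigD1 (Ordinal lt_an)) //= big1 ?addr0 => [|j /negPf neq_j].
  by rewrite eqxx mul1r.
by rewrite [_ == _ :> nat]neq_j mul0r.
Qed.

Lemma mulmx_delta n m (v : 'cV[F]_n) (f : 'I_m -> nat) i :
  ((\matrix_(i < m, j < n) (j == f i :> nat)%:R) *m v) i 0 = coordn v (f i).
Proof.
rewrite mxE; under eq_bigr => j _ do rewrite mxE -coordnE.
by rewrite sum_delta; case: ltnP => // /coordn_ge->.
Qed.

Lemma mul_row_pid n (w : 'rV[F]_n) r j : (w *m pid_mx r) 0 j = w 0 j *+ (j < r)%N.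
Proof.
rewrite (_ : pid_mx r = diag_mx (\row_(j < n) (j < r)%N%:R)).
  by rewrite mul_mx_diag !mxE mulr_natr.
apply/matrixP=> i k; rewrite !mxE -[_ == _ :> nat]/(i == k).
by case: eqP.
Qed.

Lemma mul_row_copid n (w : 'rV[F]_n) r j :
  (w *m copid_mx r) 0 j = w 0 j *+ (r <= j)%N.
Proof.
rewrite mulmxBr mulmx1 mxE [X in _ + X]mxE mul_row_pid.
by case: ltnP => _; rewrite ?subrr ?subr0.
Qed.

Lemma has_dim_init n r :
  has_dim (fun v : 'cV[F]_n => forall j, (r <= j)%N -> coordn v j = 0) (minn r n).
Proof.
have le_rn := geq_minr r n; exists n, (pid_mx (minn r n)); split; last by rewrite rank_pid_mx.
move=> v; split=> [v0|/submxP[w def_v] j le_rj].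
  suff -> : v^T = v^T *m pid_mx (minn r n) by apply: submxMl.
  apply/rowP=> j; rewrite mul_row_pid leq_min ltn_ord andbT mxE.
  by case: ltnP => // /v0; rewrite coordnE.
have [lt_jn|/coordn_ge-> //] := ltnP j n; rewrite -[j]/(val (Ordinal lt_jn)) coordnE.
by move/rowP/(_ (Ordinal lt_jn)): def_v; rewrite mul_row_pid mxE leq_min /= ltnNge le_rj.
Qed.

Lemma has_dim_final n r :
  has_dim (fun v : 'cV[F]_n => forall j, (j + r < n)%N -> coordn v j = 0) (minn r n).
Proof.
have le_n : (n - r <= n)%N by apply: leq_subr.
exists n, (copid_mx (n - r)); split; last by rewrite rank_copid_mx // minnC minnE.
move=> v; split=> [v0|/submxP[w def_v] j lt_jn].
  suff -> : v^T = v^T *m copid_mx (n - r) by apply: submxMl.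
  apply/rowP=> j; rewrite mul_row_copid mxE.
  by case: leqP => //; rewrite ltn_subRL addnC -coordnE => /v0.
have lt_j : (j < n)%N by rewrite (leq_ltn_trans _ lt_jn) ?leq_addr.
rewrite -[j]/(val (Ordinal lt_j)) coordnE.
by move/rowP/(_ (Ordinal lt_j)): def_v; rewrite mul_row_copid mxE leqNgt ltn_subRL addnC lt_jn.
Qed.

End SubspaceDimension.

(** * The subspaces of chain vectors *)

Section ChainSpaces.
Variable F : fieldType.

(* The nonzero vectors of [chain_space P Q l] are those occurring in Jordan
   chains of length at most [l]; dropping the condition [x_0 != 0] makes this a
   subspace, defined by recursion on [l]. *)
Fixpoint chain_space m n (P Q : 'M[F]_(m, n)) l (v : 'cV[F]_n) : Prop :=
  if l is l'.+1 then exists2 y, chain_space P Q l' y & P *m v = - (Q *m y)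
  else v = 0.

Lemma chain_space0 m n (P Q : 'M[F]_(m, n)) l : chain_space P Q l 0.
Proof. by elim: l => // l IHl; exists 0; rewrite // !mulmx0 oppr0. Qed.

Lemma chain_space_leq m n (P Q : 'M[F]_(m, n)) k l v :
  (k <= l)%N -> chain_space P Q k v -> chain_space P Q l v.
Proof.
elim: k l v => [|k IHk] [|l] v //= le_kl; first by move=> ->; apply: (chain_space0 P Q l.+1).
by case=> y Vy Pv; exists y => //; apply: IHk.
Qed.

Lemma chain_space_strict m n (P Q P' Q' : 'M[F]_(m, n)) (H : 'M_m) (G : 'M_n) l v :
    H \in unitmx -> G \in unitmx -> P' *m G = H *m P -> Q' *m G = H *m Q ->
  chain_space P Q l v <-> chain_space P' Q' l (G *m v).
Proof.
move=> uH uG eP eQ; elim: l v => [|l IHl] v /=.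
  split=> [->|Gv0]; first by rewrite mulmx0.
  by rewrite -(mulKmx uG v) Gv0 mulmx0.
have step y : P *m v = - (Q *m y) <-> P' *m (G *m v) = - (Q' *m (G *m y)).
  rewrite !mulmxA eP eQ -!mulmxA; split=> [->|]; first by rewrite mulmxN.
  by rewrite -mulmxN => /(can_inj (mulKmx uH)).
split=> [[y /IHl Vy /step Pv]|[z Vz Pv]]; first by exists (G *m y).
by exists (invmx G *m z); [apply/IHl | apply/step]; rewrite mulKVmx.
Qed.

Lemma chain_space_dsum m1 n1 m2 n2 (P1 Q1 : 'M[F]_(m1, n1)) (P2 Q2 : 'M[F]_(m2, n2)) l v :
  chain_space (block_mx P1 0 0 P2) (block_mx Q1 0 0 Q2) l v <->
  chain_space P1 Q1 l (usubmx v) /\ chain_space P2 Q2 l (dsubmx v).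
Proof.
have mulE (A : 'M[F]_(m1, n1)) (B : 'M_(m2, n2)) w :
    block_mx A 0 0 B *m w = col_mx (A *m usubmx w) (B *m dsubmx w).
  by rewrite -{1}[w]vsubmxK mul_block_col !mul0mx addr0 add0r.
elim: l v => [|l IHl] v /=.
  split=> [->|[u0 d0]]; first by rewrite !linear0.
  by rewrite -[v]vsubmxK u0 d0 col_mx0.
split=> [[y /IHl[V1 V2]]|[[y1 V1 e1] [y2 V2 e2]]].
  rewrite !mulE opp_col_mx => /eq_col_mx[e1 e2].
  by split; [exists (usubmx y) | exists (dsubmx y)].
exists (col_mx y1 y2); first by apply/IHl; rewrite col_mxKu col_mxKd.
by rewrite !mulE col_mxKu col_mxKd e1 e2 opp_col_mx.
Qed.

Lemma chain_space_inj m n (P Q : 'M[F]_(m, n)) l v :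
  \rank P = n -> chain_space P Q l v <-> v = 0.
Proof.
move=> rkP.
have Pinj w : P *m w = 0 -> w = 0.
  move=> Pw; apply/trmx_inj/eqP; rewrite trmx0.
  have Pfree : row_free P^T by rewrite /row_free mxrank_tr rkP.
  by rewrite -(mulmx_free_eq0 _ Pfree) -trmx_mul Pw trmx0.
elim: l v => [|l IHl] v //=.
split=> [[y /IHl-> e]|->]; last exact: (chain_space0 P Q l.+1).
by apply: Pinj; rewrite e mulmx0 oppr0.
Qed.

(** The equation reads [v_(j+1) = - y_j] with [v_0] free, so each level frees one more leading
    coordinate. The bounds on [m] cover both Jordan blocks ([m = n]) and [L_k] ([n = m + 1]). *)
Lemma chain_space_shift m n (P Q : 'M[F]_(m, n)) l v :
    (n.-1 <= m <= n)%N ->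
    (forall w (i : 'I_m), (P *m w) i 0 = coordn w i.+1) ->
    (forall w (i : 'I_m), (Q *m w) i 0 = coordn w i) ->
  chain_space P Q l v <-> forall j, (l <= j)%N -> coordn v j = 0.
Proof.
move=> /andP[le_nm le_mn] PE QE; elim: l v => [|l IHl] v /=.
  split=> [->|v0]; last by apply/colP=> i; rewrite -coordnE v0 // mxE.
  by move=> j _; rewrite /coordn; case: insubP => [i _ _|//]; rewrite mxE.
split=> [[y /IHl y0 e] [|j] // le_lj|v0].
  have [lt_jm|le_mj] := ltnP j m; last first.
    by apply: coordn_ge; rewrite -(leq_add2r 1) !addn1 in le_mj; apply: leq_trans le_mj; lia.
  have -> : coordn v j.+1 = (P *m v) (Ordinal lt_jm) 0 by rewrite PE.
  by rewrite e [LHS]mxE QE y0 // oppr0.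
exists (\col_i - coordn v i.+1).
  apply/IHl => j le_lj; have [lt_jn|/coordn_ge//] := ltnP j n.
  by rewrite (coordn_col (fun i => - coordn v i.+1)) // v0 ?oppr0.
apply/colP=> i; rewrite [RHS]mxE PE QE (coordn_col (fun i => - coordn v i.+1)) ?opprK //.
exact: leq_trans (ltn_ord i) le_mn.
Qed.

(** The roles of [P] and [Q] are exchanged, as for [L_k] at infinity: now [v_j = - y_(j+1)] and the
    last coordinate is free. *)
Lemma chain_space_unshift m n (P Q : 'M[F]_(m, n)) l v :
    (n = m.+1)%N ->
    (forall w (i : 'I_m), (P *m w) i 0 = coordn w i) ->
    (forall w (i : 'I_m), (Q *m w) i 0 = coordn w i.+1) ->
  chain_space P Q l v <-> forall j, (j + l < n)%N -> coordn v j = 0.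
Proof.
move=> def_n PE QE; elim: l v => [|l IHl] v /=.
  split=> [->|v0]; last by apply/colP=> i; rewrite -coordnE v0 ?addn0 // mxE.
  by move=> j _; rewrite /coordn; case: insubP => [i _ _|//]; rewrite mxE.
split=> [[y /IHl y0 e] j lt_j|v0].
  have lt_jm : (j < m)%N by lia.
  have -> : coordn v j = (P *m v) (Ordinal lt_jm) 0 by rewrite PE.
  rewrite e [LHS]mxE QE y0 ?oppr0 //=; lia.
(* The coordinate [y_0] does not enter the equation; the value 0 keeps [y] in the previous space. *)
pose y i := if i is i'.+1 then - coordn v i' else 0.
exists (\col_i y i).
  apply/IHl => j lt_j; rewrite coordn_col; last by lia.
  by case: j lt_j => [|j] lt_j //=; rewrite v0 ?oppr0 //; lia.
apply/colP=> i; rewrite [RHS]mxE PE QE coordn_col ?opprK // def_n ltnS.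
exact: ltn_ord.
Qed.

End ChainSpaces.

(** * Jordan chains and the chain spaces *)

Section JordanChains.
Variables (F : fieldType) (p q : nat) (A0 A1 : 'M[F]_(p, q)) (lam : option F).

Definition eig_mx := match lam with Some l => A0 + l *: A1 | None => A1 end.
Definition coeig_mx := match lam with Some _ => A1 | None => A0 end.

Lemma chain_vecs_space l v :
  chain_vecs A0 A1 lam l v -> chain_space eig_mx coeig_mx l v.
Proof.
case=> xs [[xs_gt0 _ xsP] [le_xs /(nthP 0)[i lt_i <-]]].
apply: (@chain_space_leq _ _ _ _ _ i.+1); first exact: leq_trans le_xs.
elim: i lt_i => [|i IHi] lt_i; have := xsP _ lt_i; rewrite /= => e.
  by exists 0; rewrite // mulmx0 oppr0.
by exists xs`_i => //; apply/IHi/ltnW.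
Qed.

Lemma space_chain_vecs l v :
  chain_space eig_mx coeig_mx l v -> v != 0 -> chain_vecs A0 A1 lam l v.
Proof.
(* The induction needs [v] to be the last vector of the chain, so that the chain can be
   prolonged. *)
suff chain : chain_space eig_mx coeig_mx l v -> v != 0 ->
    exists xs, [/\ jordan_chain A0 A1 lam xs, (size xs <= l)%N & last 0 xs = v].
  move=> Vv v_neq0; have [xs [xsJ le_xs def_v]] := chain Vv v_neq0.
  exists xs; split=> //; split=> //; rewrite -def_v.
  by case: xs xsJ {le_xs def_v} => [[]|x xs _] //=; rewrite mem_last.
elim: l v => [|l IHl] v /=; first by move=> ->; rewrite eqxx.
(* If the predecessor [y] is zero then [v] is an eigenvector and starts a chain; otherwise [v] is
   appended to a chain ending in [y]. *)
case=> y Vy Pv v_neq0; have [y0|y_neq0] := eqVneq y 0.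
  exists [:: v]; split=> //; split=> //= -[|] // _.
  by rewrite -/eig_mx Pv y0 mulmx0 oppr0.
have [xs [[xs_gt0 x0 xsP] le_xs def_y]] := IHl y Vy y_neq0.
exists (rcons xs v); rewrite size_rcons last_rcons; split=> //; split.
- by rewrite size_rcons.
- by rewrite nth_rcons xs_gt0.
move=> i; rewrite size_rcons ltnS leq_eqVlt => /predU1P[->|lt_i].
  rewrite nth_rcons ltnn eqxx gtn_eqF // nth_rcons prednK // leqnn.
  by rewrite nth_last def_y.
rewrite nth_rcons lt_i xsP // nth_rcons.
by case: i lt_i => //= i lt_i; rewrite ltnW.
Qed.

Lemma Ldim_chain_space l d :
  has_dim (chain_space eig_mx coeig_mx l) d -> Ldim A0 A1 lam l = d.
Proof. by apply: span_dimE => v; [apply: chain_vecs_space | apply: space_chain_vecs]. Qed.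

End JordanChains.

(** * Moving a finite eigenvalue of [L_k] to 0 *)

Section BinomialShift.
Variables (F : fieldType) (l : F).

Let g i j : F := 'C(i, j)%:R * (- l) ^+ (i - j).

(* The matrix of [f(x) |-> f(x - l)] on polynomials, transposed; it conjugates
   the evaluation of [L_k] at [l] to its evaluation at [0]. *)
Definition binom_mx n : 'M[F]_n := \matrix_(i, j) g i j.

Lemma binom_mx_unit n : binom_mx n \in unitmx.
Proof.
rewrite unitmxE det_trig.
  by rewrite big1 ?unitr1 // => i _; rewrite mxE /g binn subnn mul1r.
by apply/is_trig_mxP => i j lt_ij; rewrite mxE /g bin_small // mul0r.
Qed.

Lemma binom_mx_KL1 k :
  b1 (kblk (KL F k)) *m binom_mx k.+1 = binom_mx k *m b1 (kblk (KL F k)).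
Proof.
apply/matrixP=> i j; rewrite !mxE /=.
under eq_bigr => m _ do rewrite !mxE.
under [RHS]eq_bigr => m _ do rewrite !mxE mulrC [_ == m :> nat]eq_sym.
rewrite (sum_delta _ _ (g^~ j)) (sum_delta _ _ (g i)) ltnS ltnW //.
(* In the extra last column the binomial coefficient vanishes, since the row index is less than
   [k]. *)
by case: ltnP => // le_kj; rewrite /g bin_small ?mul0r // (leq_trans (ltn_ord i)).
Qed.

(** Entrywise this is Pascal's rule: [g i.+1 j + l * g i j] is [g i j.-1] for [j > 0], and 0 for
    [j = 0]. *)
Lemma binom_mx_KL k :
  (b0 (kblk (KL F k)) + l *: b1 (kblk (KL F k))) *m binom_mx k.+1 =
  binom_mx k *m b0 (kblk (KL F k)).
Proof.
apply/matrixP=> i j; rewrite !mxE /=.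
under eq_bigr => m _ do rewrite !mxE mulrDl -mulrA.
rewrite big_split -big_distrr /= !(sum_delta _ _ (g^~ j)) !ltnS ltn_ord ltnW // !mulr1n.
case: j => -[|j] lt_j /=.
  rewrite big1 => [|m _]; last by rewrite !mxE mulr0.
  by rewrite /g !bin0 !subn0 exprS; ring.
under [RHS]eq_bigr => m _ do rewrite !mxE eqSS mulrC [_ == m :> nat]eq_sym.
rewrite (sum_delta _ _ (g i)) -ltnS lt_j mulr1n /g binS subSS.
have [lt_ji|le_ij] := ltnP j i; last by rewrite bin_small // ?ltnS // natrD mulrDl; ring.
by rewrite -(subnSK lt_ji) exprS natrD; ring.
Qed.

End BinomialShift.

(** * Chain spaces of the Kronecker blocks and their growth *)

Section KroneckerChains.
Variables (F : fieldType) (lam : option F).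

Definition kblock_chain_dim (b : kblock F) l : nat :=
  match b with
  | KL k => minn l k.+1
  | KLT _ => 0
  | KJ mu k => if Some mu == lam then minn l k else 0
  | KN k => if None == lam then minn l k else 0
  end.

(** With [eig_s], the homogeneous coordinates of [lam]: [(1, l)] for a finite [l] and [(0, 1)] for
    infinity. *)
Definition eig_t : F := if lam is Some _ then 1 else 0.
Definition eig_s : F := if lam is Some l then l else 1.

Lemma eig_mxE p q (A0 A1 : 'M[F]_(p, q)) :
  eig_mx A0 A1 lam = pencil_at idfun eig_t eig_s A0 A1.
Proof.
rewrite /pencil_at !map_mx_id // /eig_mx /eig_t /eig_s; case: lam => [l|].
  by rewrite scale1r.
by rewrite scale0r scale1r add0r.
Qed.

Lemma rank_eig_KL k :
  \rank (eig_mx (b0 (kblk (KL F k))) (b1 (kblk (KL F k))) lam) = k.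
Proof.
rewrite eig_mxE -/(kblock_at _ _ _ (KL F k)).
case def_lam: lam => [l|].
  apply: (@mxrank_colsub_unit _ _ _ _ (lift ord0)).
  by rewrite kblock_at_KL_lift det_tr det_bidiag /eig_t def_lam expr1n oner_neq0.
apply: (@mxrank_colsub_unit _ _ _ _ (widen_ord (leqnSn k))).
by rewrite kblock_at_KL_widen det_bidiag /eig_s def_lam expr1n oner_neq0.
Qed.

Definition kblock_chain (b : kblock F) :=
  chain_space (eig_mx (b0 (kblk b)) (b1 (kblk b)) lam)
              (coeig_mx (b0 (kblk b)) (b1 (kblk b)) lam).

Arguments kblock_chain : clear implicits.

Lemma has_dim_chain_inj m n (P Q : 'M[F]_(m, n)) l :
  \rank P = n -> has_dim (chain_space P Q l) 0.
Proof. by move=> rkP; apply: has_dim_ext (has_dim0 F n) => v; apply: chain_space_inj. Qed.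

Lemma has_dim_chain_nilp n (P Q : 'M[F]_n) l :
    P = \matrix_(i, j) (j == i.+1 :> nat)%:R -> Q = \matrix_(i, j) (i == j :> nat)%:R ->
  has_dim (chain_space P Q l) (minn l n).
Proof.
move=> -> ->; apply: has_dim_ext (has_dim_init F n l) => v.
apply: chain_space_shift; first by rewrite leq_pred leqnn.
  by move=> w i; rewrite mulmx_delta.
by move=> w i; under eq_mx do rewrite eq_sym; rewrite mulmx_delta.
Qed.

Lemma has_dim_kblock_KL k l : has_dim (kblock_chain (KL F k) l) (minn l k.+1).
Proof.
rewrite /kblock_chain; case: lam => [mu|] /=; last first.
  apply: has_dim_ext (has_dim_final F k.+1 l) => v.
  by apply: chain_space_unshift => // w i; rewrite mulmx_delta.
pose G := binom_mx mu k.+1.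
have uG : G \in unitmx by apply: binom_mx_unit.
have uGV : invmx G \in unitmx by rewrite unitmx_inv.
apply: has_dim_ext (has_dim_unit uGV (has_dim_init F k.+1 l)) => v.
rewrite -{1}(mulKVmx uG v).
rewrite -(chain_space_strict _ _ (binom_mx_unit mu k) uG
            (binom_mx_KL mu k) (binom_mx_KL1 mu k)).
apply: chain_space_shift; first by rewrite leqnn leqnSn.
  by move=> w i; rewrite mulmx_delta.
by move=> w i; rewrite mulmx_delta.
Qed.

(** An [L_k^T], or a Jordan block at another eigenvalue, has full column rank at [lam], so its chain
    spaces vanish; a Jordan block at [lam] acts as a shift. *)
Lemma has_dim_kblock b l : has_dim (kblock_chain b l) (kblock_chain_dim b l).
Proof.
rewrite /kblock_chain; case: b => [k|k|mu k|k] /=.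
- exact: has_dim_kblock_KL.
- apply: has_dim_chain_inj; rewrite eig_mxE -/(kblock_at _ _ _ (KLT F k)).
  by rewrite kblock_at_KLT mxrank_tr; have := rank_eig_KL k; rewrite eig_mxE.
- case: ifPn => [/eqP def_lam|neq_lam].
    apply: has_dim_chain_nilp; rewrite -def_lam //=.
    by apply/matrixP=> i j; rewrite !mxE; ring.
  apply: has_dim_chain_inj; apply: mxrank_unit.
  rewrite eig_mxE -/(kblock_at _ _ _ (KJ mu k)) kblock_at_KJ unitmxE unitfE det_bidiag.
  rewrite expf_neq0 // /eig_t /eig_s; case: lam neq_lam => [l'|] neq_lam /=.
    by rewrite mulr1 subr_eq0; apply: contraNneq neq_lam => ->.
  by rewrite mulr0 subr0 oner_neq0.
case: ifPn => [/eqP def_lam|neq_lam].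
  by apply: has_dim_chain_nilp; rewrite -def_lam.
apply: has_dim_chain_inj; apply: mxrank_unit.
rewrite eig_mxE -/(kblock_at _ _ _ (KN F k)) kblock_at_KN unitmxE unitfE det_bidiag.
by rewrite /eig_t; case: lam neq_lam => [l'|] // _; rewrite expr1n oner_neq0.
Qed.

Lemma has_dim_chain_dsum (kb : seq (kblock F)) l :
  let D0 := dsum0 (map (@kblk F) kb) in let D1 := dsum1 (map (@kblk F) kb) in
  has_dim (chain_space (eig_mx D0 D1 lam) (coeig_mx D0 D1 lam) l)
    (\sum_(b <- kb) kblock_chain_dim b l).
Proof.
elim: kb => [|b kb IHkb] /=.
  rewrite big_nil; apply: has_dim_ext (has_dim0 F 0) => v.
  by rewrite [v]flatmx0; split=> // _; apply: chain_space0.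
rewrite big_cons; apply: has_dim_ext (has_dim_dsum (has_dim_kblock b l) IHkb) => v.
rewrite -chain_space_dsum; set P := eig_mx _ _ _; set Q := coeig_mx _ _ _.
have -> : P = block_mx (eig_mx (b0 (kblk b)) (b1 (kblk b)) lam) 0 0
    (eig_mx (dsum0 (map (@kblk F) kb)) (dsum1 (map (@kblk F) kb)) lam).
  by rewrite /P !eig_mxE pencil_at_block.
by rewrite /Q; case: lam.
Qed.

(** From [l] to [l.+1], a Jordan block of size [k] at [lam] gains one dimension when [l < k], but an
    [L_k], having [k + 1] columns, when [l <= k]. This is the origin of the shifted index of [r]. *)
Lemma kcf_chain_dim_step (kb : seq (kblock F)) l :
  (\sum_(b <- kb) kblock_chain_dim b l.+1 =
   \sum_(b <- kb) kblock_chain_dim b l +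
   (count (leq l.+1) (kcf_exps lam kb) + count (leq l) (col_min_indices kb)))%N.
Proof.
elim: kb => [|b kb IHkb]; first by rewrite !big_nil.
rewrite !big_cons IHkb.
rewrite -[kcf_exps _ (b :: kb)]/(kblock_exps lam b ++ kcf_exps lam kb) count_cat.
move: (count _ (kcf_exps _ _)) (\sum_(_ <- _) _)%N => x y.
have eqJ mu k : (if mu == lam then minn l.+1 k else 0) =
    ((if mu == lam then minn l k else 0) + count (leq l.+1) (jordan_exps lam mu k))%N.
  rewrite /jordan_exps; case: eqP => _ /=; last by rewrite count_nseq.
  by case: k => [|k] //=; rewrite count_cat count_nseq /=; lia.
case: b => [k|k|mu k|k] /=; rewrite ?count_nseq ?eqJ /=; 
  move: (count _ (col_min_indices _)) => z.
- by case: (leqP l k) => ?; lia.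
- lia.
- by move: (count _ _) (if _ then _ else _) => u v; lia.
- by move: (count _ _) (if _ then _ else _) => u v; lia.
Qed.

(** The number of columns of a block is its rank, plus one for an [L_k]; hence the number of column
    minimal indices is [q] minus the rank. *)
Lemma sum_c_kcf (kb : seq (kblock F)) :
  sum_c (map (@kblk F) kb) = (size (kcf_exps lam kb) + size (col_min_indices kb))%N.
Proof.
elim: kb => // b kb IHkb.
rewrite -[kcf_exps _ (b :: kb)]/(kblock_exps lam b ++ kcf_exps lam kb).
rewrite size_cat size_kblock_exps [LHS]/= IHkb.
by case: b => [k|k|mu k|k] /=; lia.
Qed.

End KroneckerChains.

(** * Comparison of the two sides through the canonical form *)

Theorem theorem3p8 (F : closedFieldType) (p q : nat) (A0 A1 : 'M[F]_(p, q))
    (kb : seq (kblock F)) :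
  is_KCF A0 A1 kb ->
  forall (lam : option F) (i : nat), (1 <= i)%N ->
    wseq A0 A1 lam i =
      (wR A0 A1 lam i +
       (if i.-1 == 0%N then q - pencil_rank A0 A1
        else count (fun c => i.-1 <= c)%N (col_min_indices kb)))%N.
Proof.
move=> [def_p def_q]; case: p / def_p A0 A1 => A0 A1; case: q / def_q A0 A1 => A0 A1.
rewrite !conform_mx_id => -[P [Q [uP uQ def0 def1]]] lam [//|i] _ /=.
pose s := sort leq (kcf_exps lam kb).
have equiv_s : loc_equiv (lin_form lam) (hom_pencil A0 A1) (diag_pi (lin_form lam) s).
  apply: loc_equiv_trans (loc_equiv_strict lam A0 A1 uP uQ) _; rewrite def0 def1.
  apply: loc_equiv_trans (loc_equiv_dsum lam kb) _.
  exact: loc_equiv_diag_sort.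
have rank_s : pencil_rank A0 A1 = size s.
  by rewrite size_sort -(pencil_rank_strict A0 A1 uP uQ) def0 def1 -pencil_rank_dsum.
have sum_s : (sumn s <= size s)%N.
  by rewrite size_sort (perm_sumn (permEl (perm_sort _ _))) sumn_kcf_exps.
have sorted_s : sorted leq s by apply: sort_sorted; apply: leq_total.
(* Strict equivalence by [P] and [Q] carries the chain spaces of the pencil to those of its
   canonical form through [invmx Q]. *)
have LdimE l : Ldim A0 A1 lam l = \sum_(b <- kb) kblock_chain_dim lam b l.
  apply: Ldim_chain_space; have uQV : invmx Q \in unitmx by rewrite unitmx_inv.
  apply: has_dim_ext (has_dim_unit uQV (has_dim_chain_dsum lam kb l)) => v.
  have strictE : eig_mx (P *m A0 *m Q) (P *m A1 *m Q) lam *m invmx Q = P *m eig_mx A0 A1 lam.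
    by rewrite !eig_mxE pencil_at_mul !map_mx_id // mulmxK.
  apply: chain_space_strict uP uQV _ _; rewrite -def0 -def1 //.
  by case: lam {s equiv_s rank_s sum_s sorted_s strictE} => [l'|] /=; rewrite mulmxK.
rewrite /wseq /= !LdimE kcf_chain_dim_step addKn (wRE sorted_s sum_s equiv_s rank_s).
(* Only [r_0] is left: every minimal index is at least 0, so the count is their number, which is [q]
   minus the rank. *)
rewrite /s count_sort; congr (_ + _)%N; case: eqP => // ->.
by rewrite rank_s size_sort (sum_c_kcf lam) addKn count_predT.
Qed.
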